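(* Let $T=(R,V,W,S)=\begin{pmatrix} R & V\\ W & S\end{pmatrix}$ be a Morita context and let $(I,V_1,W_1,J)=\begin{pmatrix} I & V_1\\ W_1 & J\end{pmatrix}$ be an ideal of $T$. Consider the following conditions. (1) $(I,V_1,W_1,J)$ is a prime ideal of $T$. (2) $I$ and $J$ are prime ideals of $R$ and $S$, respectively, and $V_1=\{v\in V : vW\subseteq I\}=\{v\in V : Wv\subseteq J\}$ and $W_1=\{w\in W : Vw\subseteq I\}=\{w\in W : wV\subseteq J\}$. Then (1) implies (2). If moreover $VW=R$ and $WV=S$, then (2) implies (1).
   Context: All rings are associative with $1\neq 0$ and all modules are unitary. A Morita context is a 4-tuple $(R,V,W,S)$, where $R,S$ are rings, ${}_RV_S$ and ${}_SW_R$ are bimodules, with context products $V\times W\to R$, $(v,w)\mapsto vw$, and $W\times V\to S$, $(w,v)\mapsto wv$, such that $\begin{pmatrix} R & V\\ W & S\end{pmatrix}$ is an associative ring under the usual matrix operations; this ring is also denoted $(R,V,W,S)$. For subsets $I\subseteq R$, $V_1\subseteq V$, $W_1\subseteq W$, $J\subseteq S$, $(I,V_1,W_1,J)=\begin{pmatrix} I & V_1\\ W_1 & J\end{pmatrix}$ denotes the set of all matrices $\begin{pmatrix} r & v\\ w & s\end{pmatrix}$ with $r\in I$, $v\in V_1$, $w\in W_1$, $s\in J$. Ideals are two-sided. $VW$ and $WV$ denote the sets of finite sums of context products; $vW=\{vw: w\in W\}$, and similarly for $Wv$, $Vw$, $wV$. A proper ideal $P$ of a ring $A$ is prime if for all $a,b\in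 A$, $aAb\subseteq P$ implies $a\in P$ or $b\in P$.
   Formalization: As stated, (1) implies (2) fails when I=R or J=S (e.g. V=W=0, I prime, J=S); in the general implication I is claimed prime only if I≠R, and J only if J≠S. When VW=R and WV=S the full equivalence is proved. *)

(* Defs.v *)
From HB Require Import structures.
From mathcomp Require Import all_boot all_algebra.
From mathcomp Require Import boolp classical_sets.

Set Implicit Arguments.
Unset Strict Implicit.
Unset Printing Implicit Defensive.

Import GRing.Theory.
Local Open Scope ring_scope.
Local Open Scope classical_set_scope.

Section TwoSidedIdeals.
Variable A : nzRingType.

Definition is_ideal (P : set A) : Prop :=
  [/\ P 0,
      forall x y, P x -> P y -> P (x - y),
      forall a x, P x -> P (a * x)
    & forall a x, P x -> P (x * a)].

(* Prime ideals are proper; an ideal of a Morita ring can be prime while one of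
   its diagonal blocks is the whole ring, e.g. P x S in R x S. *)
Definition is_prime_ideal (P : set A) : Prop :=
  [/\ is_ideal P,
      P <> [set: A]
    & forall a b, [set a * x * b | x in [set: A]] `<=` P -> P a \/ P b].

End TwoSidedIdeals.

(* The left action of an (R, S)-bimodule is the scaling of the lmodType;
   the right action is the function [ract]. *)
Record is_bimodule (R S : nzRingType) (V : lmodType R) (ract : V -> S -> V) :
    Prop := IsBimodule {
  ractDl : forall u v s, ract (u + v) s = ract u s + ract v s;
  ractDr : forall v s t, ract v (s + t) = ract v s + ract v t;
  ractA : forall v s t, ract v (s * t) = ract (ract v s) t;
  ract1 : forall v, ract v 1 = v;
  ract_scale : forall r v s, ract (r *: v) s = r *: ract v s
}.

Section MoritaMatrix.
Variables (R S : nzRingType) (V : lmodType R) (W : lmodType S).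

Record morita_mx : Type := MoritaMx { e11 : R; e12 : V; e21 : W; e22 : S }.

Definition mx_to_tuple (m : morita_mx) : R * V * W * S :=
  (e11 m, e12 m, e21 m, e22 m).
Definition mx_of_tuple (t : R * V * W * S) : morita_mx :=
  MoritaMx t.1.1.1 t.1.1.2 t.1.2 t.2.
Lemma mx_to_tupleK : cancel mx_to_tuple mx_of_tuple.
Proof. by case. Qed.

HB.instance Definition _ := Choice.copy morita_mx (can_type mx_to_tupleK).

Definition mx_zero := MoritaMx 0 0 0 0.
Definition mx_opp m := MoritaMx (- e11 m) (- e12 m) (- e21 m) (- e22 m).
Definition mx_add m n :=
  MoritaMx (e11 m + e11 n) (e12 m + e12 n) (e21 m + e21 n) (e22 m + e22 n).

Fact mx_addA : associative mx_add.
Proof. by move=> m n p; rewrite /mx_add /= !addrA. Qed.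
Fact mx_addC : commutative mx_add.
Proof.
move=> m n; rewrite /mx_add [e11 m + _]addrC [e12 m + _]addrC.
by rewrite [e21 m + _]addrC [e22 m + _]addrC.
Qed.
Fact mx_add0 : left_id mx_zero mx_add.
Proof. by case=> r v w s; rewrite /mx_add /= !add0r. Qed.
Fact mx_addN : left_inverse mx_zero mx_opp mx_add.
Proof. by case=> r v w s; rewrite /mx_add /= !addNr. Qed.

HB.instance Definition _ :=
  GRing.isZmodule.Build morita_mx mx_addA mx_addC mx_add0 mx_addN.

Definition morita_mul (ractV : V -> S -> V) (ractW : W -> R -> W)
    (prodVW : V -> W -> R) (prodWV : W -> V -> S) (m n : morita_mx) :=
  MoritaMx (e11 m * e11 n + prodVW (e12 m) (e21 n))
           (e11 m *: e12 n + ractV (e12 m) (e22 n))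
           (ractW (e21 m) (e11 n) + e22 m *: e21 n)
           (prodWV (e21 m) (e12 n) + e22 m * e22 n).

(* Associativity and distributivity of [morita_mul] encode that the context
   products are biadditive, balanced and compatible with each other. *)
Record morita_context : Type := MoritaContext {
  ractV : V -> S -> V;
  ractW : W -> R -> W;
  prodVW : V -> W -> R;
  prodWV : W -> V -> S;
  bimodV : is_bimodule ractV;
  bimodW : is_bimodule ractW;
  morita_mulA : associative (morita_mul ractV ractW prodVW prodWV);
  morita_mulDl : left_distributive (morita_mul ractV ractW prodVW prodWV) +%R;
  morita_mulDr : right_distributive (morita_mul ractV ractW prodVW prodWV) +%R
}.

Definition morita_ring of morita_context : Type := morita_mx.

Variable C : morita_context.

HB.instance Definition _ := GRing.Zmodule.copy (morita_ring C) morita_mx.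

Definition mx_one : morita_ring C := MoritaMx 1 0 0 1.
Definition mx_mul : morita_ring C -> morita_ring C -> morita_ring C :=
  morita_mul (ractV C) (ractW C) (prodVW C) (prodWV C).

Fact mx_mul0 : left_zero 0 mx_mul.
Proof.
move=> m; apply: (addrI (mx_mul 0 m)); rewrite addr0.
by rewrite -[LHS](morita_mulDl C) addr0.
Qed.
Fact mx_mulr0 : right_zero 0 mx_mul.
Proof.
move=> m; apply: (addrI (mx_mul m 0)); rewrite addr0.
by rewrite -[LHS](morita_mulDr C) addr0.
Qed.

Fact prodVW0l w : prodVW C 0 w = 0.
Proof.
by have /(congr1 e11) := mx_mul0 (MoritaMx 0 0 w 0); rewrite /= mul0r add0r.
Qed.
Fact prodWV0l v : prodWV C 0 v = 0.
Proof.
by have /(congr1 e22) := mx_mul0 (MoritaMx 0 v 0 0); rewrite /= mul0r addr0.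
Qed.
Fact prodVW0r v : prodVW C v 0 = 0.
Proof.
by have /(congr1 e11) := mx_mulr0 (MoritaMx 0 v 0 0); rewrite /= mul0r add0r.
Qed.
Fact prodWV0r w : prodWV C w 0 = 0.
Proof.
by have /(congr1 e22) := mx_mulr0 (MoritaMx 0 0 w 0); rewrite /= mul0r addr0.
Qed.
Fact ractV0l s : ractV C 0 s = 0.
Proof. by apply: (addrI (ractV C 0 s)); rewrite -(ractDl (bimodV C)) !addr0. Qed.
Fact ractW0l r : ractW C 0 r = 0.
Proof. by apply: (addrI (ractW C 0 r)); rewrite -(ractDl (bimodW C)) !addr0. Qed.
Fact ractV0r v : ractV C v 0 = 0.
Proof. by apply: (addrI (ractV C v 0)); rewrite -(ractDr (bimodV C)) !addr0. Qed.
Fact ractW0r w : ractW C w 0 = 0.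
Proof. by apply: (addrI (ractW C w 0)); rewrite -(ractDr (bimodW C)) !addr0. Qed.

Fact mx_mul1 : left_id mx_one mx_mul.
Proof.
case=> r v w s; rewrite /mx_mul /morita_mul /=.
by rewrite !mul1r !scale1r prodVW0l prodWV0l ractV0l ractW0l !addr0 !add0r.
Qed.
Fact mx_mulr1 : right_id mx_one mx_mul.
Proof.
case=> r v w s; rewrite /mx_mul /morita_mul /=.
rewrite !mulr1 !scaler0 prodVW0r prodWV0r (ract1 (bimodV C)) (ract1 (bimodW C)).
by rewrite !addr0 !add0r.
Qed.
Fact mx_one_neq0 : mx_one != 0.
Proof. by apply/eqP => /(congr1 e11) /eqP; rewrite /= oner_eq0. Qed.

HB.instance Definition _ :=
  GRing.Zmodule_isNzRing.Build (morita_ring C) (morita_mulA C)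
    mx_mul1 mx_mulr1 (morita_mulDl C) (morita_mulDr C) mx_one_neq0.

Definition block_set (I : set R) (V1 : set V) (W1 : set W) (J : set S) :
    set (morita_ring C) :=
  [set m | [/\ I (e11 m), V1 (e12 m), W1 (e21 m) & J (e22 m)]].

Definition prodVW_set : set R :=
  [set r | exists s : seq (V * W), r = \sum_(p <- s) prodVW C p.1 p.2].
Definition prodWV_set : set S :=
  [set t | exists s : seq (W * V), t = \sum_(p <- s) prodWV C p.1 p.2].

Definition annihilator_conditions
    (I : set R) (V1 : set V) (W1 : set W) (J : set S) : Prop :=
  [/\ V1 = [set v | [set prodVW C v w | w in [set: W]] `<=` I],
      V1 = [set v | [set prodWV C w v | w in [set: W]] `<=` J],
      W1 = [set w | [set prodVW C v w | v in [set: V]] `<=` I]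
    & W1 = [set w | [set prodWV C w v | v in [set: V]] `<=` J]].

End MoritaMatrix.

Arguments block_set {R S V W} C I V1 W1 J _.

(* Main.v *)
Require Import Defs.
From HB Require Import structures.
From mathcomp Require Import all_boot all_algebra.
From mathcomp Require Import boolp classical_sets.
Import GRing.Theory.
Local Open Scope ring_scope.
Local Open Scope classical_set_scope.

(** Let P = (I, V1, W1, J).  If P is prime, primality of I and J and the four
    annihilator conditions are obtained by testing P on matrices with a single
    nonzero entry: for v with vW included in I, the set
    [[0, v], [0, 0]] T [[0, v], [0, 0]] consists of the matrices
    [[0, (vw)v], [0, 0]], which lie in P because IV is included in V1.
    Conversely, when WV = S the annihilator conditions make P the largest ideal
    of T with upper left corner I: m is in P as soon as the upper left entry of
    every x m y is in I.  So a, b outside P yield x a y and x' b y' with upper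
    left entries outside I, and primality of I rules out a T b being inside P. *)

Section MoritaIdeals.
Set Implicit Arguments.
Unset Strict Implicit.

Lemma ideal_sum (A : nzRingType) (Q : set A) (T : Type) (s : seq T)
    (F : T -> A) : is_ideal Q -> (forall i, Q (F i)) -> Q (\sum_(i <- s) F i).
Proof.
move=> [Q0 QB _ _] QF; apply: big_ind => // x y Qx Qy.
(* Ideals are given as closed under subtraction, so x + y is written x - (0 - y). *)
by rewrite -[y]opprK -[- y]sub0r; apply: (QB) => //; apply: QB.
Qed.

Context {R S : nzRingType} {V : lmodType R} {W : lmodType S}.
Variable C : morita_context V W.

Definition unit11 (r : R) : morita_ring C := MoritaMx r 0 0 0.
Definition unit12 (v : V) : morita_ring C := MoritaMx 0 v 0 0.
Definition unit21 (w : W) : morita_ring C := MoritaMx 0 0 w 0.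
Definition unit22 (s : S) : morita_ring C := MoritaMx 0 0 0 s.

Lemma morita_mulE (m n : morita_ring C) :
  m * n = morita_mul (ractV C) (ractW C) (prodVW C) (prodWV C) m n.
Proof. by []. Qed.

Let zeroE := (mul0r, mulr0, scale0r, scaler0, prodVW0l, prodVW0r, prodWV0l,
  prodWV0r, ractV0l, ractV0r, ractW0l, ractW0r, addr0, add0r).

Ltac morita_simpl :=
  rewrite /unit11 /unit12 /unit21 /unit22 ?morita_mulE /morita_mul /= ?zeroE.

Lemma mulm11_11 r r' : unit11 r * unit11 r' = unit11 (r * r').
Proof. by morita_simpl. Qed.
Lemma mulm11_12 r v : unit11 r * unit12 v = unit12 (r *: v).
Proof. by morita_simpl. Qed.
Lemma mulm12_21 v w : unit12 v * unit21 w = unit11 (prodVW C v w).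
Proof. by morita_simpl. Qed.
Lemma mulm12_22 v s : unit12 v * unit22 s = unit12 (ractV C v s).
Proof. by morita_simpl. Qed.
Lemma mulm21_11 w r : unit21 w * unit11 r = unit21 (ractW C w r).
Proof. by morita_simpl. Qed.
Lemma mulm21_12 w v : unit21 w * unit12 v = unit22 (prodWV C w v).
Proof. by morita_simpl. Qed.
Lemma mulm22_21 s w : unit22 s * unit21 w = unit21 (s *: w).
Proof. by morita_simpl. Qed.
Lemma mulm22_22 s s' : unit22 s * unit22 s' = unit22 (s * s').
Proof. by morita_simpl. Qed.

Lemma unit11_mid r m r' : unit11 r * m * unit11 r' = unit11 (r * e11 m * r').
Proof. by morita_simpl. Qed.
(** Only the entry of m opposite to v survives. The result stays a triple product so that it can be
    bracketed either way, through [prodVW] or through [prodWV]. *)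
Lemma unit12_mid v m v' :
  unit12 v * m * unit12 v' = unit12 v * unit21 (e21 m) * unit12 v'.
Proof. by morita_simpl. Qed.
Lemma unit21_mid w m w' :
  unit21 w * m * unit21 w' = unit21 w * unit12 (e12 m) * unit21 w'.
Proof. by morita_simpl. Qed.
Lemma unit22_mid s m s' : unit22 s * m * unit22 s' = unit22 (s * e22 m * s').
Proof. by morita_simpl. Qed.

Lemma unit11B r r' : unit11 r - unit11 r' = unit11 (r - r').
Proof. by congr MoritaMx; rewrite /= ?subr0. Qed.
Lemma unit22B s s' : unit22 s - unit22 s' = unit22 (s - s').
Proof. by congr MoritaMx; rewrite /= ?subr0. Qed.

Lemma e11_mul12 v m : e11 (unit12 v * m) = prodVW C v (e21 m).
Proof. by morita_simpl. Qed.
Lemma e11_mul21 m w : e11 (m * unit21 w) = prodVW C (e12 m) w.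
Proof. by morita_simpl. Qed.
Lemma e21_mul21 m w : e21 (m * unit21 w) = e22 m *: w.
Proof. by morita_simpl. Qed.

Lemma e11_mid11 (m n : morita_ring C) r :
  e11 (m * unit11 r * n) = e11 m * r * e11 n.
Proof. by morita_simpl. Qed.

(** Associativity of T on three matrix units, read in the lower right corner. *)
Lemma prodWV_scale s w v : prodWV C (s *: w) v = s * prodWV C w v.
Proof.
have /(congr1 (@e22 _ _ _ _)) := mulrA (unit22 s) (unit21 w) (unit12 v).
by rewrite mulm22_21 !mulm21_12 mulm22_22.
Qed.

Variables (I : set R) (V1 : set V) (W1 : set W) (J : set S).
Local Notation P := (block_set C I V1 W1 J).
Hypothesis idealP : is_ideal P.

Lemma block_setMl m n : P n -> P (m * n).
Proof. by case: idealP => _ _ + _; apply. Qed.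
Lemma block_setMr m n : P m -> P (m * n).
Proof. by case: idealP => _ _ _; apply. Qed.

(** The zero matrix lies in P, so every block contains 0 and only the displayed entry matters. *)
Lemma block_set_unit11 r : P (unit11 r) <-> I r.
Proof. by case: idealP => -[? ? ? ?] _ _ _; split => [[]|]. Qed.
Lemma block_set_unit12 v : P (unit12 v) <-> V1 v.
Proof. by case: idealP => -[? ? ? ?] _ _ _; split => [[]|]. Qed.
Lemma block_set_unit21 w : P (unit21 w) <-> W1 w.
Proof. by case: idealP => -[? ? ? ?] _ _ _; split => [[]|]. Qed.
Lemma block_set_unit22 s : P (unit22 s) <-> J s.
Proof. by case: idealP => -[? ? ? ?] _ _ _; split => [[]|]. Qed.

Lemma ideal_corner11 : is_ideal I.
Proof.
have [P0 PB _ _] := idealP; split.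
- by case: P0.
- move=> x y /block_set_unit11 Ix /block_set_unit11 Iy.
  by apply/block_set_unit11; rewrite -unit11B; apply: PB.
- move=> a x /block_set_unit11 Ix.
  by apply/block_set_unit11; rewrite -mulm11_11; apply: block_setMl.
- move=> a x /block_set_unit11 Ix.
  by apply/block_set_unit11; rewrite -mulm11_11; apply: block_setMr.
Qed.

Lemma ideal_corner22 : is_ideal J.
Proof.
have [P0 PB _ _] := idealP; split.
- by case: P0.
- move=> x y /block_set_unit22 Jx /block_set_unit22 Jy.
  by apply/block_set_unit22; rewrite -unit22B; apply: PB.
- move=> a x /block_set_unit22 Jx.
  by apply/block_set_unit22; rewrite -mulm22_22; apply: block_setMl.
- move=> a x /block_set_unit22 Jx.
  by apply/block_set_unit22; rewrite -mulm22_22; apply: block_setMr.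
Qed.

(** Properness of I is a separate assumption: with V = W = 0 and Q prime in S, the ideal R x Q of R
    x S is prime while its corner I is R. *)
Lemma prime_corner11 : is_prime_ideal P -> I <> [set: R] -> is_prime_ideal I.
Proof.
move=> [_ _ primeP] properI; split=> // [|a b aRb]; first exact: ideal_corner11.
have: [set unit11 a * m * unit11 b | m in [set: _]] `<=` P.
  move=> _ [m _ <-]; rewrite unit11_mid.
  by apply/block_set_unit11/aRb; exists (e11 m).
by case/primeP => /block_set_unit11; [left | right].
Qed.

Lemma prime_corner22 : is_prime_ideal P -> J <> [set: S] -> is_prime_ideal J.
Proof.
move=> [_ _ primeP] properJ; split=> // [|a b aSb]; first exact: ideal_corner22.
have: [set unit22 a * m * unit22 b | m in [set: _]] `<=` P.
  move=> _ [m _ <-]; rewrite unit22_mid.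
  by apply/block_set_unit22/aSb; exists (e22 m).
by case/primeP => /block_set_unit22; [left | right].
Qed.

Lemma prime_annihilators :
  is_prime_ideal P -> annihilator_conditions C I V1 W1 J.
Proof.
move=> [_ _ primeP].
(* The case a = b of primality; it gives the inclusion of each annihilator in V1 or W1. *)
have semiprime m : (forall x, P (m * x * m)) -> P m.
  by move=> Pm; case: (primeP m m) => // _ [x _ <-].
split; apply/seteqP; split=> [x Px _ [y _ <-]|x xP].
- apply/block_set_unit11; rewrite -mulm12_21.
  exact/block_setMr/block_set_unit12.
- apply/block_set_unit12/semiprime => m; rewrite unit12_mid mulm12_21.
  by apply/block_setMr/block_set_unit11/xP; exists (e21 m).
- apply/block_set_unit22; rewrite -mulm21_12.
  exact/block_setMl/block_set_unit12.
(* Here Wv lies in J, so v w v is bracketed as v (w v). *)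
- apply/block_set_unit12/semiprime => m; rewrite unit12_mid -mulrA mulm21_12.
  by apply/block_setMl/block_set_unit22/xP; exists (e21 m).
- apply/block_set_unit11; rewrite -mulm12_21.
  exact/block_setMl/block_set_unit21.
- apply/block_set_unit21/semiprime => m; rewrite unit21_mid -mulrA mulm12_21.
  by apply/block_setMl/block_set_unit11/xP; exists (e12 m).
- apply/block_set_unit22; rewrite -mulm21_12.
  exact/block_setMr/block_set_unit21.
- apply/block_set_unit21/semiprime => m; rewrite unit21_mid mulm21_12.
  by apply/block_setMr/block_set_unit22/xP; exists (e12 m).
Qed.

(** If I = R, then V1 = V and W1 = W because 1 acts as the identity on V and W; hence J contains WV
    = S and P = T. *)
Lemma corner11_proper :
  prodWV_set C = [set: S] -> P <> [set: morita_ring C] -> I <> [set: R].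
Proof.
move=> WVS properP IR; apply: properP.
have P11 : P (unit11 1) by apply/block_set_unit11; rewrite IR.
have V1T v : V1 v.
  apply/block_set_unit12; rewrite -[v]scale1r -mulm11_12; exact: block_setMr.
have W1T w : W1 w.
  apply/block_set_unit21; rewrite -[w](ract1 (bimodW C)) -mulm21_11.
  exact: block_setMl.
apply/seteqP; split=> // m _; split=> //; first by rewrite IR.
have : prodWV_set C (e22 m) by rewrite WVS.
case=> s ->; apply: ideal_sum ideal_corner22 _ => p.
apply/block_set_unit22; rewrite -mulm21_12.
exact/block_setMl/block_set_unit12.
Qed.

Lemma corner22_proper :
  prodVW_set C = [set: R] -> P <> [set: morita_ring C] -> J <> [set: S].
Proof.
move=> VWR properP JS; apply: properP.
have P22 : P (unit22 1) by apply/block_set_unit22; rewrite JS.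
have V1T v : V1 v.
  apply/block_set_unit12; rewrite -[v](ract1 (bimodV C)) -mulm12_22.
  exact: block_setMl.
have W1T w : W1 w.
  apply/block_set_unit21; rewrite -[w]scale1r -mulm22_21; exact: block_setMr.
apply/seteqP; split=> // m _; split=> //; last by rewrite JS.
have : prodVW_set C (e11 m) by rewrite VWR.
case=> s ->; apply: ideal_sum ideal_corner11 _ => p.
apply/block_set_unit11; rewrite -mulm12_21.
exact/block_setMr/block_set_unit12.
Qed.

(** The factors x and y, each 1 or a matrix unit, move an entry of m to the upper left corner, where
    the descriptions of V1 and W1 by I apply. The entry in S is reached through W1 and WV = S. *)
Lemma block_set_corner11 (m : morita_ring C) :
    prodWV_set C = [set: S] -> annihilator_conditions C I V1 W1 J ->
  (forall x y, I (e11 (x * m * y))) -> P m.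
Proof.
move=> WVS [V1I _ W1I W1J] Im; split.
- by have := Im 1 1; rewrite mul1r mulr1.
- rewrite V1I => _ [w _ <-].
  by have := Im 1 (unit21 w); rewrite mul1r e11_mul21.
- rewrite W1I => _ [v _ <-].
  by have := Im (unit12 v) 1; rewrite mulr1 e11_mul12.
- have W1m w : W1 (e22 m *: w).
    rewrite W1I => _ [v _ <-]; have := Im (unit12 v) (unit21 w).
    by rewrite -mulrA e11_mul12 e21_mul21.
  (* With 1 a sum of products w v, the entry s is the sum of the (s w) v; each s w is in W1, so each
     term is in J by the description of W1 by J. *)
  have : prodWV_set C 1 by rewrite WVS.
  case=> s s1; rewrite -[e22 m]mulr1 s1 mulr_sumr.
  apply: ideal_sum ideal_corner22 _ => p; rewrite -prodWV_scale.
  by have := W1m p.1; rewrite {1}W1J; apply; exists p.2.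
Qed.

Lemma corner11_prime :
    prodWV_set C = [set: S] -> annihilator_conditions C I V1 W1 J ->
  is_prime_ideal I -> is_prime_ideal P.
Proof.
move=> WVS annP [_ properI primeI]; split=> // [PT|a b aTb].
  apply: properI; apply/seteqP; split=> // r _.
  by apply/block_set_unit11; rewrite PT.
have escape m : ~ P m -> exists x y, ~ I (e11 (x * m * y)).
  move=> nPm; apply: contrapT => noxy; apply/nPm/block_set_corner11 => // x y.
  by apply: contrapT => nI; apply: noxy; exists x, y.
apply: contrapT => /not_orP[/escape[x [y nIa]] /escape[x' [y' nIb]]].
case: (primeI (e11 (x * a * y)) (e11 (x' * b * y'))) => // _ [r _ <-].
rewrite -e11_mid11.
(* The upper left entry of this element of P is the product of those of x a y and x' b y' with r in
   between. *)
have [] : P (x * (a * (y * unit11 r * x') * b) * y') => //.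
  by apply/block_setMr/block_setMl/aTb; exists (y * unit11 r * x').
by rewrite !mulrA.
Qed.

End MoritaIdeals.

Theorem theorem2p7 (R S : nzRingType) (V : lmodType R) (W : lmodType S)
    (C : morita_context V W)
    (I : set R) (V1 : set V) (W1 : set W) (J : set S) :
  is_ideal (block_set C I V1 W1 J) ->
  (is_prime_ideal (block_set C I V1 W1 J) ->
     [/\ (I <> [set: R] -> is_prime_ideal I),
         (J <> [set: S] -> is_prime_ideal J)
       & annihilator_conditions C I V1 W1 J])
  /\
  (prodVW_set C = [set: R] -> prodWV_set C = [set: S] ->
     (is_prime_ideal (block_set C I V1 W1 J) <->
      [/\ is_prime_ideal I,
          is_prime_ideal J
        & annihilator_conditions C I V1 W1 J])).
Proof.
move=> idealP; split=> [primeP|VWR WVS].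
  by split; [exact: prime_corner11 primeP | exact: prime_corner22 primeP
            | exact: prime_annihilators].
split=> [primeP|[primeI _ annP]]; last exact: corner11_prime.
have [_ properP _] := primeP; split; last exact: prime_annihilators.
- exact: prime_corner11 idealP primeP (corner11_proper idealP _ properP).
- exact: prime_corner22 idealP primeP (corner22_proper idealP _ properP).
Qed.
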